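(* Let $\gamma>0$, $p>0$, $p_2\ge p$, $b>0$, $q_{\max}>b+p/\gamma$, and let $p_r\in[0,1]$ be the probability of call. The contract described in the context is incentive compatible on the reported energy consumption under demand response: a consumer informs the truthful consumption under demand response according to his preferences. That is, the consumer's optimal report $\hat q^*$ satisfies $$\hat q^*=q_1^*,$$ where $q_1^*$ is the consumption that the consumer optimally chooses, given his optimal reports, when he is called.
   Context: Notation: $(x)_+=\max(x,0)$. All quantities are real numbers for a single consumer: $b$ is the true baseline, $\gamma$ the marginal-utility parameter, $p$ the energy price, $p_2$ the incentive/penalty price, $q_{\max}$ the maximum allowable consumption, $\hat b$ the reported baseline, $\hat q$ the reported reduced consumption under demand response, $q$ the actual consumption, and $r\in\{0,1\}$ indicates whether the consumer is called ($r=1$) or not ($r=0$), with $\Pr(r=1)=p_r$. The contract requires $\hat b\ge\hat q$. Utility function (the consumer's preferences): $$G(q;b)=\begin{cases}-\frac{\gamma}{2}q^2+(\gamma b+p)q & 0\le q\le b+\frac{p}{\gamma},\\ \frac{p^2}{2\gamma}+\frac{\gamma b^2}{2}+pb & q>b+\frac{p}{\gamma}.\end{cases}$$ Payment scheme of the contract: $$\pi_3^{r}(q;\hat b,\hat q)=\begin{cases}p\max(\hat b,q) & r=0,\\ pq-p_2(\hat b-q)_+ +p_2|q-\hat q| & r=1.\end{cases}$$ Optimal behaviour. In the second stage, given reports $(\hat b,\hat q)$ and $r$, the consumer chooses $q_r^*(\hat b,\hat q)=\arg\max_{q\in[0,q_{\max}]}G(q;b)-\pi_3^{r}(q;\hat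 b,\hat q)$. In the first stage, anticipating this, he chooses the optimal reports $(\hat b^*,\hat q^* )$ as the argmax, over $0\le\hat q\le\hat b\le q_{\max}$, of $$p_r\big[G(q_1^*;b)-\pi_3^{1}(q_1^*;\hat b,\hat q)\big]+(1-p_r)\big[G(q_0^*;b)-\pi_3^{0}(q_0^*;\hat b,\hat q)\big].$$ In the claim, $q_1^*=q_1^*(\hat b^*,\hat q^* )$.
   Formalization: At p_r=0 the optimal report is not unique and the claim fails for some optimal reports; the formal theorem proves q̂*=q_1^* for every optimal report when p_r>0, and for all p_r in [0,1] that some optimal report is truthful. *)

(* Defs.v *)
From Stdlib Require Import Reals.
Open Scope R_scope.

Definition is_argmax {T : Type} (S : T -> Prop) (f : T -> R) (x : T) : Prop :=
  S x /\ forall y : T, S y -> f y <= f x.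

Definition pos_part (x : R) : R := Rmax x 0.

(* Consumption is nonnegative: only the values of [utility] at q >= 0 are
   meaningful, and only those are ever compared below. *)
Definition utility (gamma p b q : R) : R :=
  if Rle_dec q (b + p / gamma)
  then - (gamma / 2) * q ^ 2 + (gamma * b + p) * q
  else p ^ 2 / (2 * gamma) + gamma * b ^ 2 / 2 + p * b.

(* [r = true] means that the consumer is called; [bh] and [qh] are the reported
   baseline and the reported reduced consumption. *)
Definition payment (p p2 : R) (r : bool) (bh qh q : R) : R :=
  if r
  then p * q - p2 * pos_part (bh - q) + p2 * Rabs (q - qh)
  else p * Rmax bh q.

Definition payoff (gamma p p2 b : R) (r : bool) (bh qh q : R) : R :=
  utility gamma p b q - payment p p2 r bh qh q.

Definition feasible_reports (qmax : R) (rep : R * R) : Prop :=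
  0 <= snd rep /\ snd rep <= fst rep /\ fst rep <= qmax.

(* The second-stage maximizer need not be unique, so a second-stage strategy
   [qs r bh qh] is any selection of maximizers over all feasible reports. *)
Definition optimal_consumption (gamma p p2 b qmax : R)
    (qs : bool -> R -> R -> R) : Prop :=
  forall (r : bool) (bh qh : R), feasible_reports qmax (bh, qh) ->
    is_argmax (fun q => 0 <= q <= qmax) (payoff gamma p p2 b r bh qh)
      (qs r bh qh).

Definition expected_payoff (gamma p p2 b pr : R)
    (qs : bool -> R -> R -> R) (rep : R * R) : R :=
  let (bh, qh) := rep in
  pr * payoff gamma p p2 b true bh qh (qs true bh qh) +
  (1 - pr) * payoff gamma p p2 b false bh qh (qs false bh qh).

Definition optimal_reports (gamma p p2 b qmax pr : R)
    (qs : bool -> R -> R -> R) (bh qh : R) : Prop :=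
  is_argmax (feasible_reports qmax) (expected_payoff gamma p p2 b pr qs)
    (bh, qh).

(* Main.v *)
(** The called payoff is [U(q) - p q + p2 ((bh - q)_+ - |q - qh|)], where [U]
    is the utility; the uncalled payoff does not involve [qh].  If the called
    consumption [q] differs from [qh], the reports [(max bh q, q)] are strictly
    better when called; when not called they cost nothing, because raising
    [bh] is only needed if [bh < q], which forces [q <= b], and the uncalled
    optimum is the same for all [bh <= b].  Optimal reports exist because the
    payoffs are bounded by tangent lines of the concave function [U]. *)
Require Import Defs.
From Stdlib Require Import Reals Lra Psatz.
Open Scope R_scope.

(** * Concavity and monotonicity of the utility *)

Lemma utility_below (gamma p b q : R) :
  q <= b + p / gamma ->
  utility gamma p b q = - (gamma / 2) * q ^ 2 + (gamma * b + p) * q.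
Proof. intros H; unfold utility; destruct (Rle_dec _ _); lra. Qed.

Lemma utility_above (gamma p b q : R) :
  0 < gamma -> b + p / gamma <= q ->
  utility gamma p b q = gamma / 2 * (b + p / gamma) ^ 2.
Proof.
intros Hg H; unfold utility; destruct (Rle_dec _ _) as [H'|H'].
- replace q with (b + p / gamma) by lra; field; lra.
- field; lra.
Qed.

(** The slope is the marginal utility at [x]; the quadratic branch is strictly concave and the flat
    branch continues it with matching slope 0. *)
Lemma utility_tangent_strict (gamma p b x y : R) :
  0 < gamma -> x < b + p / gamma -> y <> x ->
  utility gamma p b y
    < utility gamma p b x + (gamma * b + p - gamma * x) * (y - x).
Proof.
intros Hg Hx Hyx.
rewrite (utility_below _ _ _ x) by lra.
assert (Ht : gamma * b + p = gamma * (b + p / gamma)) by (field; lra).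
destruct (Rle_dec y (b + p / gamma)) as [Hy|Hy].
- rewrite utility_below by assumption.
  assert (0 < (y - x) ^ 2) by (assert (y - x <> 0) by lra; nra).
  nra.
- rewrite utility_above, Ht by lra.
  set (t := b + p / gamma) in *.
  (* The tangent exceeds the saturated value by [gamma / 2 * (t - x) ^ 2 + gamma * (t - x) * (y -
     t)]. *)
  assert (0 < (t - x) * (y - t)) by (apply Rmult_lt_0_compat; lra).
  assert (0 < gamma * ((t - x) * (y - t))) by (apply Rmult_lt_0_compat; lra).
  assert (0 < gamma * (t - x) ^ 2)
    by (apply Rmult_lt_0_compat; [lra | apply pow_lt; lra]).
  nra.
Qed.

Lemma utility_tangent (gamma p b x y : R) :
  0 < gamma -> x < b + p / gamma ->
  utility gamma p b y
    <= utility gamma p b x + (gamma * b + p - gamma * x) * (y - x).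
Proof.
intros Hg Hx; destruct (Req_dec y x) as [->|Hyx].
- lra.
- apply Rlt_le, utility_tangent_strict; assumption.
Qed.

Lemma utility_le_max (gamma p b q : R) :
  0 < gamma -> utility gamma p b q <= gamma / 2 * (b + p / gamma) ^ 2.
Proof.
intros Hg; destruct (Rle_dec q (b + p / gamma)) as [Hq|Hq].
- rewrite utility_below by assumption.
  assert (Ht : gamma * b + p = gamma * (b + p / gamma)) by (field; lra).
  rewrite Ht; pose proof (pow2_ge_0 (b + p / gamma - q)); nra.
- rewrite utility_above by lra; lra.
Qed.

Lemma utility_mono (gamma p b x y : R) :
  0 < gamma -> x <= y -> utility gamma p b x <= utility gamma p b y.
Proof.
intros Hg Hxy; destruct (Rlt_dec y (b + p / gamma)) as [Hy|Hy].
- pose proof (utility_tangent gamma p b y x Hg Hy) as H.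
  assert (Ht : gamma * b + p = gamma * (b + p / gamma)) by (field; lra).
  rewrite Ht in H.
  assert (0 <= gamma * ((b + p / gamma - y) * (y - x)))
    by (apply Rmult_le_pos; [|apply Rmult_le_pos]; lra).
  nra.
- rewrite (utility_above _ _ _ y) by lra; apply utility_le_max; assumption.
Qed.

(** Marginal utility decreases and equals [p] exactly at the true baseline [b]. *)
Lemma utility_slope_le_price (gamma p b x y : R) :
  0 < gamma -> 0 < p -> b <= x <= y ->
  utility gamma p b y <= utility gamma p b x + p * (y - x).
Proof.
intros Hg Hp Hxy; destruct (Rlt_dec x (b + p / gamma)) as [Hx|Hx].
- pose proof (utility_tangent gamma p b x y Hg Hx).
  assert (0 <= gamma * ((x - b) * (y - x)))
    by (apply Rmult_le_pos; [|apply Rmult_le_pos]; lra).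
  nra.
- rewrite (utility_above _ _ _ x) by lra.
  pose proof (utility_le_max gamma p b y Hg); nra.
Qed.

Lemma net_utility_max (gamma p b q : R) :
  0 < gamma -> 0 < p -> q <> b ->
  utility gamma p b q - p * q < utility gamma p b b - p * b.
Proof.
intros Hg Hp Hq.
assert (0 < p / gamma) by (apply Rdiv_lt_0_compat; assumption).
pose proof (utility_tangent_strict gamma p b b q Hg ltac:(lra) Hq); lra.
Qed.

(** * Bounds on the called and uncalled payoffs *)

Lemma called_payoff_self (gamma p p2 b bh q : R) :
  q <= bh ->
  payoff gamma p p2 b true bh q q
    = utility gamma p b q - p * q + p2 * (bh - q).
Proof.
intros H; unfold payoff, payment, pos_part.
rewrite Rmax_left, Rminus_diag, Rabs_R0; lra.
Qed.

Lemma called_payoff_le (gamma p p2 b bh qh q : R) :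
  0 <= p2 -> qh <= bh ->
  payoff gamma p p2 b true bh qh q
    <= utility gamma p b q - p * q + p2 * (bh - q).
Proof.
intros Hp2 H; unfold payoff, payment, pos_part.
assert (Rmax (bh - q) 0 - Rabs (q - qh) <= bh - q).
{ unfold Rmax, Rabs; destruct (Rle_dec _ _), (Rcase_abs _); lra. }
nra.
Qed.

(** [Rmax bh q - q] equals [pos_part (bh - q)], so the reward is unchanged and the gain is exactly
    the deviation penalty [p2 * Rabs (q - qh)]. *)
Lemma called_payoff_self_lt (gamma p p2 b bh qh q : R) :
  0 < p2 -> qh <= bh -> q <> qh ->
  payoff gamma p p2 b true bh qh q
    < payoff gamma p p2 b true (Rmax bh q) q q.
Proof.
intros Hp2 H Hq; rewrite called_payoff_self by apply Rmax_r.
unfold payoff, payment, pos_part.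
assert (Rmax (bh - q) 0 - Rabs (q - qh) < Rmax bh q - q).
{ unfold Rmax, Rabs.
  destruct (Rle_dec (bh - q) 0), (Rle_dec bh q), (Rcase_abs (q - qh)); lra. }
nra.
Qed.

Lemma uncalled_payoff_self (gamma p p2 b bh qh : R) :
  payoff gamma p p2 b false bh qh bh = utility gamma p b bh - p * bh.
Proof. unfold payoff, payment; rewrite Rmax_left; lra. Qed.

(** The bill already covers [Rmax bh q], so consuming that much loses nothing. *)
Lemma uncalled_payoff_le (gamma p p2 b bh qh q : R) :
  0 < gamma ->
  payoff gamma p p2 b false bh qh q
    <= utility gamma p b (Rmax bh q) - p * Rmax bh q.
Proof.
intros Hg; unfold payoff, payment.
pose proof (utility_mono gamma p b q (Rmax bh q) Hg (Rmax_r _ _)); lra.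
Qed.

Lemma uncalled_payoff_le_baseline (gamma p p2 b bh qh q : R) :
  0 < gamma -> 0 < p ->
  payoff gamma p p2 b false bh qh q <= utility gamma p b b - p * b.
Proof.
intros Hg Hp; pose proof (uncalled_payoff_le gamma p p2 b bh qh q Hg).
destruct (Req_dec (Rmax bh q) b) as [E|E].
- rewrite E in *; lra.
- pose proof (net_utility_max gamma p b _ Hg Hp E); lra.
Qed.

(** * Truthfulness of optimal reports *)

(** Lets alternative reports be valued at hand-picked consumptions, without knowing what [qs]
    selects there. *)
Lemma expected_payoff_ge (gamma p p2 b qmax pr : R)
    (qs : bool -> R -> R -> R) (bh qh q1 q0 : R) :
  0 <= pr <= 1 -> optimal_consumption gamma p p2 b qmax qs ->
  feasible_reports qmax (bh, qh) -> 0 <= q1 <= qmax -> 0 <= q0 <= qmax ->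
  pr * payoff gamma p p2 b true bh qh q1
    + (1 - pr) * payoff gamma p p2 b false bh qh q0
  <= expected_payoff gamma p p2 b pr qs (bh, qh).
Proof.
intros Hpr Hqs Hf H1 H0; unfold expected_payoff.
apply Rplus_le_compat; apply Rmult_le_compat_l; try lra;
  apply (Hqs _ _ _ Hf); assumption.
Qed.

Lemma called_consumption_le_baseline (gamma p p2 b qmax bh qh q : R) :
  0 < gamma -> 0 < p -> 0 < p2 -> 0 < b -> b <= qmax ->
  feasible_reports qmax (bh, qh) ->
  is_argmax (fun q => 0 <= q <= qmax) (payoff gamma p p2 b true bh qh) q ->
  bh < q -> q <= b.
Proof.
intros Hg Hp Hp2 Hb Hbm [F1 [F2 F3]] [Hq Hmax] Hlt; simpl in *.
destruct (Rle_dec q b) as [|Hqb]; [assumption|exfalso].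
(* Above [bh] each unit costs [p + p2], while above [b] it is worth at most [p]: cutting back to [y]
   gains at least [p2 * (q - y)]. *)
set (y := Rmax bh b).
assert (Hy : bh <= y /\ b <= y /\ y < q).
{ repeat split; [apply Rmax_l | apply Rmax_r | apply Rmax_lub_lt; lra]. }
specialize (Hmax y ltac:(lra)).
unfold payoff, payment, pos_part in Hmax.
rewrite !Rmax_right, !Rabs_pos_eq in Hmax by lra.
pose proof (utility_slope_le_price gamma p b y q Hg Hp ltac:(lra)).
nra.
Qed.

Lemma optimal_report_self (gamma p p2 b qmax pr : R)
    (qs : bool -> R -> R -> R) (bh qh : R) :
  0 < gamma -> 0 < p -> 0 < p2 -> 0 < b -> b <= qmax -> 0 < pr <= 1 ->
  optimal_consumption gamma p p2 b qmax qs ->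
  optimal_reports gamma p p2 b qmax pr qs bh qh -> qh = qs true bh qh.
Proof.
intros Hg Hp Hp2 Hb Hbm Hpr Hqs [Hf Hopt].
destruct (Req_dec (qs true bh qh) qh) as [E|E]; [now symmetry|exfalso].
pose proof (Hqs true bh qh Hf) as H1.
destruct (Hqs false bh qh Hf) as [Hq0 _].
set (q := qs true bh qh) in *; set (q0 := qs false bh qh) in *.
pose proof (proj1 H1) as Hq.
pose proof (fun H => called_consumption_le_baseline gamma p p2 b qmax bh qh q
              Hg Hp Hp2 Hb Hbm Hf H1 H) as Hqb.
destruct Hf as [F1 [F2 F3]]; simpl in F1, F2, F3.
pose proof (called_payoff_self_lt gamma p p2 b bh qh q Hp2 F2 E) as Hlt.
assert (Hf' : feasible_reports qmax (Rmax bh q, q)).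
{ repeat split; simpl; [lra | apply Rmax_r | apply Rmax_lub; lra]. }
(* If [bh] is unchanged, [q0] still serves; otherwise the new baseline is [q <= b], and consuming
   [b] attains the uncalled upper bound. *)
assert (H0 : exists q0', 0 <= q0' <= qmax /\
  payoff gamma p p2 b false bh qh q0
    <= payoff gamma p p2 b false (Rmax bh q) q q0').
{ destruct (Rle_dec q bh) as [Hle|Hle].
  - exists q0; split; [assumption|].
    rewrite Rmax_left by assumption; apply Rle_refl.
  - exists b; split; [lra|].
    rewrite Rmax_right by lra.
    eapply Rle_trans; [apply uncalled_payoff_le_baseline; assumption|].
    unfold payoff, payment; rewrite Rmax_right by (apply Hqb; lra); lra. }
destruct H0 as [q0' [Hq0' H0]].
pose proof (expected_payoff_ge gamma p p2 b qmax pr qs _ _ q q0'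
              ltac:(lra) Hqs Hf' Hq Hq0') as Hge.
specialize (Hopt _ Hf').
unfold expected_payoff in Hopt at 2; fold q q0 in Hopt.
assert (0 < pr * (payoff gamma p p2 b true (Rmax bh q) q q
                  - payoff gamma p p2 b true bh qh q))
  by (apply Rmult_lt_0_compat; lra).
assert (0 <= (1 - pr) * (payoff gamma p p2 b false (Rmax bh q) q q0'
                  - payoff gamma p p2 b false bh qh q0))
  by (apply Rmult_le_pos; lra).
lra.
Qed.

(** * Existence of optimal reports *)

(* Once [qh = q], the called payoff is linear in [bh], and what remains is to
   maximize [utility q - (p + p2) q] over [q >= 0]. *)
Lemma reduced_consumption_exists (gamma p p2 b : R) :
  0 < gamma -> 0 < p -> 0 < p2 -> 0 < b ->
  exists q, 0 <= q <= b /\ forall y, 0 <= y ->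
    utility gamma p b y - (p + p2) * y <= utility gamma p b q - (p + p2) * q.
Proof.
intros Hg Hp Hp2 Hb.
assert (0 < p / gamma) by (apply Rdiv_lt_0_compat; assumption).
assert (0 < p2 / gamma) by (apply Rdiv_lt_0_compat; assumption).
assert (E : gamma * (p2 / gamma) = p2) by (field; lra).
(* Marginal utility equals [p + p2] at [b - p2 / gamma]; a negative value is clipped to 0. *)
destruct (Rle_dec 0 (b - p2 / gamma)) as [Hle|Hle].
- exists (b - p2 / gamma); split; [lra|]; intros y Hy.
  pose proof (utility_tangent gamma p b (b - p2 / gamma) y Hg ltac:(lra)) as H'.
  replace (gamma * b + p - gamma * (b - p2 / gamma)) with (p + p2) in H' by lra.
  lra.
- exists 0; split; [lra|]; intros y Hy.
  pose proof (utility_tangent gamma p b 0 y Hg ltac:(lra)).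
  assert (gamma * b <= p2) by nra.
  nra.
Qed.

(* The best baseline trades the called marginal gain [pr * p2] against the
   uncalled marginal cost, which is [(1 - pr) * gamma * (bh - b)] until it
   saturates at [(1 - pr) * p]. *)
Lemma reported_baseline_exists (gamma p p2 b qmax pr : R) :
  0 < gamma -> 0 < p -> 0 < p2 -> 0 < b -> b + p / gamma < qmax ->
  0 <= pr <= 1 ->
  exists bh, b <= bh <= qmax /\ forall h qh q, h <= qmax ->
    pr * (p2 * h) + (1 - pr) * payoff gamma p p2 b false h qh q
    <= pr * (p2 * bh) + (1 - pr) * (utility gamma p b bh - p * bh).
Proof.
intros Hg Hp Hp2 Hb Hqm Hpr.
assert (0 < p / gamma) by (apply Rdiv_lt_0_compat; assumption).
destruct (Rle_dec ((1 - pr) * p) (pr * p2)) as [Hc|Hc].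
- exists qmax; split; [lra|]; intros h qh q Hh.
  assert (payoff gamma p p2 b false h qh q
          <= utility gamma p b qmax - p * h).
  { rewrite utility_above by lra; unfold payoff, payment.
    pose proof (utility_le_max gamma p b q Hg).
    pose proof (Rmax_l h q); nra. }
  assert ((1 - pr) * payoff gamma p p2 b false h qh q
          <= (1 - pr) * (utility gamma p b qmax - p * h))
    by (apply Rmult_le_compat_l; lra).
  assert (0 <= (pr * p2 - (1 - pr) * p) * (qmax - h))
    by (apply Rmult_le_pos; lra).
  lra.
- assert (Hpr1 : 0 < 1 - pr) by nra.
  (* Equating the marginal gain and cost gives [s = gamma * (bh - b)]; [s < p] keeps this [bh] below
     saturation. *)
  set (s := pr * p2 / (1 - pr)).
  assert (Es : pr * p2 = (1 - pr) * s) by (unfold s; field; lra).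
  assert (Hs : 0 <= s < p) by (split; nra).
  assert (Esg : gamma * (s / gamma) = s) by (field; lra).
  assert (0 <= s / gamma) by nra.
  assert (s / gamma < p / gamma)
    by (apply Rmult_lt_compat_r; [apply Rinv_0_lt_compat|]; lra).
  exists (b + s / gamma); split; [lra|]; intros h qh q Hh.
  rewrite <- !Rmult_assoc, Es, !Rmult_assoc, <- !Rmult_plus_distr_l.
  apply Rmult_le_compat_l; [lra|].
  pose proof (uncalled_payoff_le gamma p p2 b h qh q Hg).
  pose proof (Rmax_l h q).
  (* Net of the price, the tangent falls at rate [s] in [Rmax h q >= h], which offsets the gain
     [s * h]. *)
  pose proof (utility_tangent gamma p b (b + s / gamma) (Rmax h q) Hg
                ltac:(lra)) as Ht.
  replace (gamma * b + p - gamma * (b + s / gamma)) with (p - s) in Ht by lra.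
  nra.
Qed.

(** The upper bound separates into a term in the called consumption and a term in the baseline.
    Their maximizers satisfy [qh <= b <= bh], hence are jointly feasible, and consuming [qh] when
    called and [bh] otherwise attains the bound. *)
Lemma optimal_reports_exist (gamma p p2 b qmax pr : R)
    (qs : bool -> R -> R -> R) :
  0 < gamma -> 0 < p -> 0 < p2 -> 0 < b -> b + p / gamma < qmax ->
  0 <= pr <= 1 -> optimal_consumption gamma p p2 b qmax qs ->
  exists bh qh, optimal_reports gamma p p2 b qmax pr qs bh qh.
Proof.
intros Hg Hp Hp2 Hb Hqm Hpr Hqs.
destruct (reduced_consumption_exists gamma p p2 b) as [qh [Hq HA]];
  try assumption.
destruct (reported_baseline_exists gamma p p2 b qmax pr) as [bh [Hbh HB]];
  try assumption.
exists bh, qh.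
assert (Hf : feasible_reports qmax (bh, qh)) by (repeat split; simpl; lra).
split; [assumption|]; intros [h k] Hf'.
eapply Rle_trans;
  [|apply (expected_payoff_ge _ _ _ _ qmax _ _ bh qh qh bh); try assumption; lra].
pose proof (proj1 (Hqs true h k Hf')) as Hq1.
destruct Hf' as [F1 [F2 F3]]; simpl in F1, F2, F3.
unfold expected_payoff.
set (q1 := qs true h k) in *; set (q0 := qs false h k).
specialize (HA q1 ltac:(lra)); specialize (HB h k q0 F3).
pose proof (called_payoff_le gamma p p2 b h k q1 ltac:(lra) F2).
assert (pr * payoff gamma p p2 b true h k q1
        <= pr * (utility gamma p b qh - (p + p2) * qh + p2 * h))
  by (apply Rmult_le_compat_l; lra).
rewrite called_payoff_self by lra.
rewrite uncalled_payoff_self.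
lra.
Qed.

(** Serves the case [pr = 0]. With both reports at [b], the reward never exceeds the deviation
    penalty, so the payoff is at most [utility gamma p b q - p * q], with equality at its unique
    maximizer [b]. *)
Lemma truthful_baseline_consumption (gamma p p2 b qmax : R)
    (qs : bool -> R -> R -> R) :
  0 < gamma -> 0 < p -> 0 <= p2 -> 0 < b -> b <= qmax ->
  optimal_consumption gamma p p2 b qmax qs -> qs true b b = b.
Proof.
intros Hg Hp Hp2 Hb Hbm Hqs.
assert (Hf : feasible_reports qmax (b, b)) by (repeat split; simpl; lra).
destruct (Hqs true b b Hf) as [Hq Hmax].
set (q := qs true b b) in *.
destruct (Req_dec q b) as [|E]; [assumption|exfalso].
specialize (Hmax b ltac:(lra)).
rewrite called_payoff_self in Hmax by lra.
pose proof (net_utility_max gamma p b q Hg Hp E).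
assert (payoff gamma p p2 b true b b q <= utility gamma p b q - p * q).
{ unfold payoff, payment, pos_part.
  assert (Rmax (b - q) 0 - Rabs (q - b) <= 0)
    by (unfold Rmax, Rabs; destruct (Rle_dec _ _), (Rcase_abs _); lra).
  nra. }
lra.
Qed.

Theorem corollary4 (gamma p p2 b qmax pr : R)
  (Hgamma : 0 < gamma) (Hp : 0 < p) (Hp2 : p <= p2) (Hb : 0 < b)
  (Hqmax : b + p / gamma < qmax) (Hpr : 0 <= pr <= 1)
  (qs : bool -> R -> R -> R)
  (Hqs : optimal_consumption gamma p p2 b qmax qs) :
  (0 < pr -> forall bh qh : R,
     optimal_reports gamma p p2 b qmax pr qs bh qh -> qh = qs true bh qh) /\
  (exists bh qh : R,
     optimal_reports gamma p p2 b qmax pr qs bh qh /\ qh = qs true bh qh).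
Proof.
assert (Hc : 0 < p / gamma) by (apply Rdiv_lt_0_compat; assumption).
assert (Hself : 0 < pr -> forall bh qh,
  optimal_reports gamma p p2 b qmax pr qs bh qh -> qh = qs true bh qh).
{ intros Hpr0 bh qh.
  apply optimal_report_self; try assumption; lra. }
split; [exact Hself|].
destruct (Rlt_dec 0 pr) as [Hpr0|Hpr0].
- destruct (optimal_reports_exist gamma p p2 b qmax pr qs)
    as [bh [qh Hopt]]; try assumption; try lra.
  exists bh, qh; split; [assumption | now apply Hself].
- (* A consumer who is never called is indifferent to [qh]. *)
  assert (pr = 0) as -> by lra.
  exists b, b; split.
  + assert (Hf : feasible_reports qmax (b, b)) by (repeat split; simpl; lra).
    split; [assumption|]; intros [h k] _.
    eapply Rle_trans;
      [|apply (expected_payoff_ge _ _ _ _ qmax _ _ b b b b);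
        try assumption; lra].
    unfold expected_payoff.
    pose proof (uncalled_payoff_le_baseline gamma p p2 b h k (qs false h k)
                  Hgamma Hp).
    rewrite uncalled_payoff_self.
    lra.
  + symmetry; apply (truthful_baseline_consumption gamma p p2 b qmax);
      try assumption; lra.
Qed.
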